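(* Let $v^{(s)}_\theta, v^{(t)}_\theta : [0,1]\times\mathbb{R}^n \to \mathbb{R}^n$ be two time-dependent velocity fields (the source and the target diffusion model), each such that the ordinary differential equation $\mathrm{d}\mathbf{x}/\mathrm{d}t = v(t,\mathbf{x}(t))$ on $[0,1]$ has, for every value prescribed at time $0$ or at time $1$, exactly one solution on all of $[0,1]$. Let $\mathrm{ODESolve}$ denote the exact (zero discretization error) solution map of such an equation. Given a point $\mathbf{x}^{(s)} \in \mathbb{R}^n$ (a sample from the source domain), define $$\mathbf{x}^{(l)} = \mathrm{ODESolve}(\mathbf{x}^{(s)}; v^{(s)}_\theta, 0, 1), \qquad \mathbf{x}^{(t)} = \mathrm{ODESolve}(\mathbf{x}^{(l)}; v^{(t)}_\theta, 1, 0),$$ $$\mathbf{x}'^{(l)} = \mathrm{ODESolve}(\mathbf{x}^{(t)}; v^{(t)}_\theta, 0, 1), \qquad \mathbf{x}'^{(s)} = \mathrm{ODESolve}(\mathbf{x}'^{(l)}; v^{(s)}_\theta, 1, 0).$$ Then $\mathbf{x}^{(s)} = \mathbf{x}'^{(s)}$.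
   Context: For a velocity field $v:[0,1]\times\mathbb{R}^n\to\mathbb{R}^n$ and times $t_0,t_1\in[0,1]$ (with $t_0<t_1$ or $t_0>t_1$), $\mathrm{ODESolve}(\cdot\,; v, t_0, t_1)$ is the map sending the value $\mathbf{x}(t_0)$ of a solution of $\mathrm{d}\mathbf{x}/\mathrm{d}t = v(t,\mathbf{x}(t))$ to its value at time $t_1$: $$\mathrm{ODESolve}(\mathbf{x}(t_0); v, t_0, t_1) = \mathbf{x}(t_1) = \mathbf{x}(t_0) + \int_{t_0}^{t_1} v(t, \mathbf{x}(t))\,\mathrm{d}t .$$ ''Zero discretization error'' means that this map is computed exactly. In the intended application $v_\theta(t,\mathbf{x}) = \mathbf{f}(\mathbf{x},t) - \tfrac12 g(t)^2\, \mathbf{s}_{t,\theta}(\mathbf{x})$ is the velocity field of the probability flow ODE of a diffusion model with drift $\mathbf{f}$, scalar diffusion coefficient $g$, and learned score network $\mathbf{s}_{t,\theta}$ (an approximation of the score $\nabla_{\mathbf{x}}\log p_t(\mathbf{x})$). The superscripts $(s)$, $(l)$, $(t)$ are labels meaning ''source'', ''latent'' and ''target''. *)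

(* Defs.v *)
From mathcomp Require Import all_boot all_order all_algebra.
From mathcomp Require Import all_classical all_reals all_analysis.

Set Implicit Arguments.
Unset Strict Implicit.
Unset Printing Implicit Defensive.

Import Order.TTheory GRing.Theory Num.Theory.
Import numFieldNormedType.Exports.

Local Open Scope classical_set_scope.
Local Open Scope ring_scope.

(* Velocity fields on [0, 1] x R^n and trajectories on [0, 1] are encoded as
   total functions of a real time; nothing below depends on their values at
   times outside [0, 1], and trajectories are compared on [0, 1] only. *)

(* The derivative is the limit of difference quotients at times s in [0, 1],
   s <> t: two-sided for 0 < t < 1, one-sided for t = 0 and t = 1. *)
Definition is_solution (R : realType) (n : nat)
    (v : R -> 'rV[R]_n -> 'rV[R]_n) (x : R -> 'rV[R]_n) : Prop :=
  forall t : R, t \in `[0, 1] ->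
    (s - t)^-1 *: (x s - x t) @[s --> within `[0, 1] t^'] --> v t (x t).

Definition unique_solution_from (R : realType) (n : nat)
    (v : R -> 'rV[R]_n -> 'rV[R]_n) (t0 : R) (a : 'rV[R]_n) : Prop :=
  (exists x, is_solution v x /\ x t0 = a) /\
  (forall x y, is_solution v x -> x t0 = a ->
               is_solution v y -> y t0 = a ->
     forall t : R, t \in `[0, 1] -> x t = y t).

Definition well_posed (R : realType) (n : nat)
    (v : R -> 'rV[R]_n -> 'rV[R]_n) : Prop :=
  forall a : 'rV[R]_n,
    unique_solution_from v 0 a /\ unique_solution_from v 1 a.

(* Value at time t1 of a chosen solution through a at time t0; the default
   trajectory of xget is used only when there is no such solution. *)
Definition ODESolve (R : realType) (n : nat) (a : 'rV[R]_n)
    (v : R -> 'rV[R]_n -> 'rV[R]_n) (t0 t1 : R) : 'rV[R]_n :=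
  xget (fun=> 0) [set x : R -> 'rV[R]_n | is_solution v x /\ x t0 = a] t1.

(* Main.v *)
(* Each solver call returns the value of a solution; that solution is also the
   unique one through its value at the other endpoint, so solving back along the
   same field recovers the starting point. Cancel the v_t round trip first, then
   the v_s one. *)
Require Import Defs.
From mathcomp Require Import all_boot all_order all_algebra.
From mathcomp Require Import all_classical all_reals all_analysis.

Import Order.TTheory GRing.Theory Num.Theory.

Local Open Scope ring_scope.

(** The trajectory picked by [xget] need not be [x] itself; uniqueness only makes the two agree on
    [[0, 1]], hence the condition on [t1]. *)
Lemma ODESolveE (R : realType) (n : nat) (v : R -> 'rV[R]_n -> 'rV[R]_n)
    (x : R -> 'rV[R]_n) (t0 t1 : R) :
  unique_solution_from v t0 (x t0) -> is_solution v x -> t1 \in `[0, 1] ->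
  ODESolve (x t0) v t0 t1 = x t1.
Proof.
move=> [_ uniq_x] sol_x t1_01; rewrite /ODESolve.
(* The default case is void: [x] itself lies in the set. *)
case: xgetP => [y _ [sol_y y_t0]|/(_ x) []//].
exact: uniq_x.
Qed.

(** The times are left general because the [v_t] round trip starts at 1 and the [v_s] one at 0. *)
Lemma ODESolveK (R : realType) (n : nat) (v : R -> 'rV[R]_n -> 'rV[R]_n)
    (t0 t1 : R) (a : 'rV[R]_n) :
  (forall b, unique_solution_from v t0 b) ->
  (forall b, unique_solution_from v t1 b) ->
  t0 \in `[0, 1] -> t1 \in `[0, 1] ->
  ODESolve (ODESolve a v t0 t1) v t1 t0 = a.
Proof.
move=> wp0 wp1 t0_01 t1_01; have [[x [sol_x <-]] _] := wp0 a.
(* The inner call becomes [x t1], so the outer call starts on the same [x]. *)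
by rewrite !(ODESolveE _ _ v x).
Qed.

Theorem proposition3p1 (R : realType) (n : nat)
    (v_s v_t : R -> 'rV[R]_n -> 'rV[R]_n)
    (wp_s : well_posed v_s) (wp_t : well_posed v_t)
    (x_s x_l x_t x_l' x_s' : 'rV[R]_n)
    (def_x_l : x_l = ODESolve x_s v_s 0 1)
    (def_x_t : x_t = ODESolve x_l v_t 1 0)
    (def_x_l' : x_l' = ODESolve x_t v_t 0 1)
    (def_x_s' : x_s' = ODESolve x_l' v_s 1 0) :
  x_s = x_s'.
Proof.
have mem0 : (0 : R) \in `[0, 1] by rewrite in_itv /= lexx ler01.
have mem1 : (1 : R) \in `[0, 1] by rewrite in_itv /= lexx ler01.
rewrite def_x_s' def_x_l' def_x_t ODESolveK //; try by move=> b; case: (wp_t b).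
by rewrite def_x_l ODESolveK // => b; case: (wp_s b).
Qed.
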